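(* In the algorithm described in the context, which samples uniformly from the oscillating tableaux of length $N$ and shape $\lambda$, the choice of whether to add or remove a box from the partition at step $X$ depends only on $X$ and on the area of the current partition, not on any other details about the shape of the partition. This means that the areas of the partitions in an oscillating tableau can themselves be described by a random walk, independent of the details of the partitions' shapes.
   Context: For a partition $\mu$, its area $|\mu|$ is the number of boxes of its Young diagram, and $f^\mu$ is the number of standard Young tableaux of shape $\mu$. An oscillating tableau of length $N$ and shape $\lambda$ is a sequence of partitions $\{\lambda^{(0)}=\emptyset,\lambda^{(1)},\dots,\lambda^{(N)}=\lambda\}$ in which each partition differs from the previous one by adding or removing a single corner box. Fix $\lambda$ with $|\lambda|=k$ and $N=k+2n$, $n\in\mathbb{N}$. The sampling algorithm is as follows. Set $\lambda^{(N)}=\lambda$, $X=0$, $Y=k$. While $X<N$: with probability $\frac{Y}{N-X}$, remove a corner box from $\lambda^{(N-X)}$ using the hook-walk algorithm of Greene, Nijenhuis and Wilf (which produces each partition $\mu$ obtained from $\nu$ by removing a corner with probability $f^\mu/f^\nu$), call the result $\lambda^{(N-X-1)}$, and replace $X$ by $X+1$ and $Y$ by $Y-1$; otherwise, add a corner box to $\lambda^{(N-X)}$ using the complementary hook-walk algorithm of the same authors (which produces each partition $\mu$ obtained from $\nu$ by adding a box with probability $f^\mu/((|\nu|+1)f^\nu)$), call the result $\lambda^{(N-X-1)}$, and replace $X$ by $X+1$ and $Y$ by $Y+1$. Return $\{\lambda^{(0)}=\emptyset,\lambda^{(1)},\dots,\lambda^{(N)}=\lambda\}$. Throughout, $Y$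 is the area of the current partition $\lambda^{(N-X)}$. *)

(* Defs.v *)
From mathcomp Require Import all_boot all_order all_algebra.

Set Implicit Arguments.
Unset Strict Implicit.
Unset Printing Implicit Defensive.

Import GRing.Theory Num.Theory.

(* A partition is the weakly decreasing sequence of its (positive) row lengths;
   its area is [sumn mu]. *)
Definition is_part (mu : seq nat) : bool :=
  sorted geq mu && all (leq 1) mu.

(* The filter discards the junk results of [incr_nth] at rows where no box can
   be added.  Row [size nu] is the first empty row. *)
Definition box_additions (nu : seq nat) : seq (seq nat) :=
  [seq mu <- [seq incr_nth nu i | i <- iota 0 (size nu).+1] | is_part mu].

(* Row [i] ends in a corner iff it is strictly longer than row [i.+1]; a row
   that becomes empty is dropped. *)
Definition box_removals (nu : seq nat) : seq (seq nat) :=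
  [seq [seq r <- set_nth 0 nu i (nth 0 nu i).-1 | 0 < r]
    | i <- iota 0 (size nu) & nth 0 nu i.+1 < nth 0 nu i].

(* [t] lists the rows of the tableau from top to bottom. *)
Definition is_syt (mu : seq nat) (t : seq (seq nat)) : bool :=
  [&& shape t == mu,
      perm_eq (flatten t) (iota 1 (sumn mu)),
      all (sorted ltn) t
    & all (fun i => all (fun j =>
             nth 0 (nth [::] t i) j < nth 0 (nth [::] t i.+1) j)
             (iota 0 (size (nth [::] t i.+1))))
          (iota 0 (size t).-1)].

(* Every filling of [mu] by 1, ..., [sumn mu] is [reshape mu w] for exactly one
   permutation [w] of these entries, its row reading. *)
Definition nb_syt (mu : seq nat) : nat :=
  count (is_syt mu) [seq reshape mu w | w <- permutations (iota 1 (sumn mu))].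

Definition box_step (mu nu : seq nat) : bool :=
  (nu \in box_additions mu) || (nu \in box_removals mu).

(* [T] is the sequence of the partitions of indices 0, ..., N. *)
Definition osc_tableau (N : nat) (la : seq nat) : pred (seq (seq nat)) :=
  fun T => [&& size T == N.+1, all is_part T, head [::] T == [::],
               last [::] T == la & sorted box_step T].

Local Open Scope ring_scope.

(* Finitely supported laws, as lists of weighted outcomes.  An outcome may occur
   several times, so laws are compared by the weights they give to events. *)
Definition dist (A : Type) := seq (rat * A).

Definition ret A (x : A) : dist A := [:: (1, x)].

Definition bind A B (d : dist A) (f : A -> dist B) : dist B :=
  [seq (p.1 * q.1, q.2) | p <- d, q <- f p.2].

Definition dmap A B (f : A -> B) (d : dist A) : dist B :=
  bind d (fun x => ret (f x)).

Definition choice A (p : rat) (d1 d2 : dist A) : dist A :=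
  [seq (p * q.1, q.2) | q <- d1] ++ [seq ((1 - p) * q.1, q.2) | q <- d2].

Definition unif A (s : seq A) : dist A := [seq ((size s)%:R^-1, x) | x <- s].

Definition Pr A (d : dist A) (E : pred A) : rat := \sum_(p <- d | E p.2) p.1.

Definition cPr A (d : dist A) (E H : pred A) : rat := Pr d (predI E H) / Pr d H.

Definition same_law A (d d' : dist A) : Prop := forall E : pred A, Pr d E = Pr d' E.

(* The output laws of the (complementary) hook walk of Greene, Nijenhuis and
   Wilf. *)
Definition hook_walk (nu : seq nat) : dist (seq nat) :=
  [seq ((nb_syt mu)%:R / (nb_syt nu)%:R, mu) | mu <- box_removals nu].

Definition co_hook_walk (nu : seq nat) : dist (seq nat) :=
  [seq ((nb_syt mu)%:R / ((sumn nu).+1%:R * (nb_syt nu)%:R), mu)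
    | mu <- box_additions nu].

Definition removal_prob (N X Y : nat) : rat := Y%:R / (N%:R - X%:R).

(* The while loop.  [T] is the part of the output built so far, with the current
   partition, of index [N - X], at its head; [Y] is a counter of the program.
   [fuel] bounds the number of iterations.  In the removal branch [Y.-1]
   truncates only at [Y = 0], where the branch has probability 0. *)
Fixpoint sample_loop (fuel N X Y : nat) (T : seq (seq nat)) :
    dist (seq (seq nat)) :=
  if fuel is fuel'.+1 then
    if (X < N)%N then
      choice (removal_prob N X Y)
        (bind (hook_walk (head [::] T))
          (fun mu => sample_loop fuel' N X.+1 Y.-1 (mu :: T)))
        (bind (co_hook_walk (head [::] T))
          (fun mu => sample_loop fuel' N X.+1 Y.+1 (mu :: T)))
    else ret T
  else ret T.

(* [X] increases at each iteration, so [N] iterations exhaust the loop. *)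
Definition sample_osc (N : nat) (la : seq nat) : dist (seq (seq nat)) :=
  sample_loop N N 0 (sumn la) [:: la].

(* The random walk on the natural numbers that at time [X] goes from [Y] to
   [Y - 1] with probability [removal_prob N X Y] and to [Y + 1] otherwise.  The
   trajectory is accumulated backwards, so that, as in an oscillating tableau,
   the position at time [X] has index [N - X]. *)
Fixpoint walk_loop (fuel N X Y : nat) (a : seq nat) : dist (seq nat) :=
  if fuel is fuel'.+1 then
    choice (removal_prob N X Y)
      (walk_loop fuel' N X.+1 Y.-1 (Y.-1 :: a))
      (walk_loop fuel' N X.+1 Y.+1 (Y.+1 :: a))
  else ret a.

Definition area_walk (N k : nat) : dist (seq nat) := walk_loop N N 0 k [:: k].

Definition areas (T : seq (seq nat)) : seq nat := [seq sumn mu | mu <- T].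

(* The partitions visited up to step [X], those of indices [N - X], ..., [N],
   are [h]; the current one is [head [::] h]. *)
Definition history (N X : nat) (h : seq (seq nat)) : pred (seq (seq nat)) :=
  fun T => drop (N - X) T == h.

Definition removes_at (N X : nat) : pred (seq (seq nat)) :=
  fun T => nth [::] T (N - X.+1) \in box_removals (nth [::] T (N - X)).

Definition adds_at (N X : nat) : pred (seq (seq nat)) :=
  fun T => nth [::] T (N - X.+1) \in box_additions (nth [::] T (N - X)).

(* Main.v *)
Require Import Defs.
From mathcomp Require Import all_boot all_order all_algebra zify ring.
Import GRing.Theory Num.Theory.

(* Removing the largest entry of a standard tableau gives the branching rule
   [f^nu = sum of f^mu over the removals mu of nu].  Adding a box and then removing
   one differs from the opposite order by exactly one copy of the identity (Young's
   lattice is a differential poset), so by induction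
   [(|nu| + 1) f^nu = sum of f^mu over the additions mu of nu].  Both hook walks are
   therefore probability laws, and the number of oscillating tableaux of length [m]
   and shape [mu] is [c(m, |mu|) f^mu], where [c(m, Y)] satisfies
   [c(m + 1, Y) = c(m, Y - 1) + (Y + 1) c(m, Y + 1)].  The identity
   [(m + 1) c(m, Y) = (Y + 1) c(m + 1, Y + 1)] says that the removal probability
   [Y / m] is the proportion of the oscillating tableaux of length [m] whose last
   step is an addition, and so each step of the algorithm picks the previous
   partition with its frequency under the uniform law.  Given the history, the rest
   of the output is thus uniform too, which gives the conditional probabilities. *)

(** * Adding and removing boxes *)

(** A default that does not occur in a list marks its end, so [nth] determines the length as well as
    the entries. It is applied to partitions with default 0 and to tableaux without empty rows. *)
Lemma eq_nth_notin (T : eqType) (x0 : T) (s1 s2 : seq T) :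
  x0 \notin s1 -> x0 \notin s2 -> nth x0 s1 =1 nth x0 s2 -> s1 = s2.
Proof.
elim: s1 s2 => [|a s1 IH] [|b s2] //=.
- by move=> _; rewrite inE negb_or => /andP[/eqP + _] /(_ 0) /= => H /H.
- by rewrite inE negb_or => /andP[/eqP + _] _ /(_ 0) /= => H /esym /H.
rewrite !inE !negb_or => /andP[_ h1] /andP[_ h2] e.
by rewrite (e 0 : a = b) (IH s2) // => i; exact: (e i.+1).
Qed.

Lemma sumn_incr_nth (s : seq nat) (i : nat) : sumn (incr_nth s i) = (sumn s).+1.
Proof.
elim: s i => [|a s IH] [|i] //=; last by rewrite IH addnS.
by elim: i => //= i ->.
Qed.

Lemma is_partP (mu : seq nat) :
  reflect (0 \notin mu /\ forall i, nth 0 mu i.+1 <= nth 0 mu i) (is_part mu).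
Proof.
rewrite /is_part andbC.
have -> : all (leq 1) mu = (0 \notin mu).
  by elim: mu => //= a l ->; rewrite inE negb_or lt0n eq_sym.
apply: (iffP andP) => -[h0 h]; split=> //.
- move=> i; case: (ltnP i.+1 (size mu)) => hi; last by rewrite nth_default.
  by move/(sortedP 0): h => /(_ _ hi).
- by apply/(sortedP 0) => i _; exact: h.
Qed.

Lemma part_eq (mu nu : seq nat) :
  is_part mu -> is_part nu -> nth 0 mu =1 nth 0 nu -> mu = nu.
Proof. by move=> /is_partP[h1 _] /is_partP[h2 _]; exact: eq_nth_notin. Qed.

Lemma part_nthS {mu : seq nat} (i : nat) :
  is_part mu -> nth 0 mu i.+1 <= nth 0 mu i.
Proof. by case/is_partP. Qed.

Lemma part_nth_gt0 {mu : seq nat} (i : nat) :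
  is_part mu -> (0 < nth 0 mu i) = (i < size mu).
Proof.
move=> /is_partP[h _]; case: (ltnP i) => hi; last by rewrite nth_default.
by rewrite lt0n; apply: contraNneq h => <-; exact: mem_nth.
Qed.

(** The zeros of a weakly decreasing list form a tail, and [nth] reads 0 past the end anyway. *)
Lemma nth_filter_gt0 (l : seq nat) (i : nat) :
  sorted geq l -> nth 0 [seq r <- l | 0 < r] i = nth 0 l i.
Proof.
elim: l i => [|a l IH] i //= hp.
case: (posnP a) => [a0|_]; last by case: i => //= i; exact/IH/(path_sorted hp).
have l0 : all (pred1 0) l.
  have gtr : transitive geq by move=> x y z; rewrite /geq /= => /[swap]; exact: leq_trans.
  apply/allP => x xl; move/(order_path_min gtr): hp => /allP /(_ _ xl).
  by rewrite a0 /geq /= leqn0.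
rewrite (@eq_in_filter _ _ pred0) => [|x /(allP l0) /eqP -> //].
rewrite filter_pred0 nth_nil a0; case: i => //= i.
case: (ltnP i (size l)) => hi; last by rewrite nth_default.
by have /eqP -> := all_nthP 0 l0 i hi.
Qed.

(** Past row [size nu] the two lengths compared are both 0, so the condition already confines [i] to
    the rows enumerated by [box_additions]. *)
Definition addable (nu : seq nat) (i : nat) : bool :=
  (i == 0) || (nth 0 nu i < nth 0 nu i.-1).

Definition removable (nu : seq nat) (i : nat) : bool :=
  nth 0 nu i.+1 < nth 0 nu i.

Definition remove_box (nu : seq nat) (i : nat) : seq nat :=
  [seq r <- set_nth 0 nu i (nth 0 nu i).-1 | 0 < r].

Lemma is_part_incr_nth (nu : seq nat) (i : nat) :
  is_part nu -> is_part (incr_nth nu i) = addable nu i.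
Proof.
move=> pnu; apply/is_partP/idP => [[h0 h]|].
  rewrite /addable; case: i h0 h => //= i h0 /(_ i).
  by rewrite !nth_incr_nth eqxx (gtn_eqF (ltnSn i)) add0n.
rewrite /addable => ai.
have isz : i <= size nu.
  case: i ai => //= i; rewrite -(part_nth_gt0 _ pnu); exact: leq_ltn_trans.
split=> [|j].
  (* A zero entry of [incr_nth nu i] could only be padding at a row strictly between the end of [nu]
     and row [i]; [isz] excludes it. *)
  apply/negP => /(nthP 0) [j]; rewrite size_incr_nth nth_incr_nth => hj.
  move/eqP; rewrite addn_eq0 eqb0 => /andP[ij].
  rewrite -leqn0 leqNgt part_nth_gt0 // => hs; move: hj; case: ifP; lia.
rewrite !nth_incr_nth; have := part_nthS j pnu.
case: (eqVneq i j.+1) ai => [-> /= | _ _] /=; lia.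
Qed.

Lemma addable_leq_size {nu : seq nat} {i : nat} :
  is_part nu -> addable nu i -> i <= size nu.
Proof.
rewrite /addable => pnu; case: i => //= i.
by rewrite -(part_nth_gt0 _ pnu); exact: leq_ltn_trans.
Qed.

Lemma removable_lt_size {nu : seq nat} {i : nat} : removable nu i -> i < size nu.
Proof.
rewrite /removable; case: (ltnP i (size nu)) => // hi.
by rewrite (nth_default _ hi).
Qed.

Lemma set_nth_sorted (nu : seq nat) (i : nat) :
  is_part nu -> removable nu i -> sorted geq (set_nth 0 nu i (nth 0 nu i).-1).
Proof.
move=> pnu ri; apply/(sortedP 0) => j _; rewrite !nth_set_nth /= /geq /=.
have := part_nthS j pnu; rewrite /removable in ri.
case: (eqVneq j i) => [e|ne]; case: (eqVneq j.+1 i) => [e'|ne'] /=;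
  rewrite ?e ?e' in ri *; lia.
Qed.

Lemma is_part_remove_box {nu : seq nat} {i : nat} :
  is_part nu -> removable nu i -> is_part (remove_box nu i).
Proof.
move=> pnu ri; rewrite /is_part filter_all andbT sorted_filter ?set_nth_sorted //.
by move=> x y z; rewrite /geq /= => /[swap]; exact: leq_trans.
Qed.

Lemma nth_remove_box {nu : seq nat} {i : nat} (j : nat) :
  is_part nu -> removable nu i ->
  nth 0 (remove_box nu i) j = nth 0 nu j - (i == j).
Proof.
move=> pnu ri; rewrite nth_filter_gt0 ?set_nth_sorted // nth_set_nth /=.
by case: eqVneq => [->|]; rewrite ?eqxx ?subn1 // subn0.
Qed.

Lemma size_remove_box {nu : seq nat} {i : nat} :
  removable nu i -> size (remove_box nu i) <= size nu.
Proof.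
move=> /removable_lt_size hi; rewrite size_filter (leq_trans (count_size _ _)) //.
by rewrite size_set_nth; apply/eq_leq/maxn_idPr.
Qed.

Lemma incr_nthK {nu : seq nat} {i : nat} :
  is_part nu -> addable nu i ->
  removable (incr_nth nu i) i /\ remove_box (incr_nth nu i) i = nu.
Proof.
move=> pnu ai.
have ri : removable (incr_nth nu i) i.
  rewrite /removable !nth_incr_nth eqxx (ltn_eqF (ltnSn i)) add0n add1n ltnS.
  exact: part_nthS.
have pi : is_part (incr_nth nu i) by rewrite is_part_incr_nth.
split=> //; apply: part_eq => // [|j]; first exact: is_part_remove_box.
by rewrite nth_remove_box // nth_incr_nth addKn.
Qed.

Lemma remove_boxK {nu : seq nat} {i : nat} :
  is_part nu -> removable nu i ->
  addable (remove_box nu i) i /\ incr_nth (remove_box nu i) i = nu.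
Proof.
move=> pnu ri; have pr := is_part_remove_box pnu ri.
have ai : addable (remove_box nu i) i.
  rewrite /addable !nth_remove_box // eqxx.
  case: i ri {pr} => //= i; rewrite /removable => ri; have := part_nthS i pnu.
  by rewrite (gtn_eqF (ltnSn i)); lia.
split=> //; apply: part_eq => // [|j]; first by rewrite is_part_incr_nth.
rewrite nth_incr_nth nth_remove_box //; rewrite /removable in ri.
case: eqVneq => [<-|]; lia.
Qed.

Lemma box_additionsE (nu : seq nat) : is_part nu ->
  box_additions nu = [seq incr_nth nu i | i <- iota 0 (size nu).+1 & addable nu i].
Proof.
move=> pnu; rewrite /box_additions filter_map; congr map.
by apply: eq_filter => i /=; rewrite is_part_incr_nth.
Qed.

Lemma box_removalsE (nu : seq nat) :
  box_removals nu = [seq remove_box nu i | i <- iota 0 (size nu) & removable nu i].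
Proof. by []. Qed.

Lemma mem_additionsP (nu mu : seq nat) : is_part nu ->
  reflect (exists2 i, addable nu i & mu = incr_nth nu i) (mu \in box_additions nu).
Proof.
move=> pnu; rewrite box_additionsE //; apply: (iffP mapP) => -[i].
  by rewrite mem_filter => /andP[ai _] ->; exists i.
move=> ai ->; exists i => //.
by rewrite mem_filter ai mem_iota ltnS (addable_leq_size pnu).
Qed.

Lemma mem_removalsP (nu mu : seq nat) :
  reflect (exists2 i, removable nu i & mu = remove_box nu i) (mu \in box_removals nu).
Proof.
rewrite box_removalsE; apply: (iffP mapP) => -[i].
  by rewrite mem_filter => /andP[ai _] ->; exists i.
move=> ai ->; exists i => //.
by rewrite mem_filter ai mem_iota (removable_lt_size ai).
Qed.

Lemma is_part_addition {nu mu : seq nat} :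
  is_part nu -> mu \in box_additions nu -> is_part mu.
Proof. by rewrite mem_filter => _ /andP[]. Qed.

Lemma is_part_removal {nu mu : seq nat} :
  is_part nu -> mu \in box_removals nu -> is_part mu.
Proof. by move=> pnu /mem_removalsP[i ri ->]; exact: is_part_remove_box. Qed.

Lemma sumn_addition {nu mu : seq nat} :
  is_part nu -> mu \in box_additions nu -> sumn mu = (sumn nu).+1.
Proof. by move=> pnu /mem_additionsP[] // i ai ->; rewrite sumn_incr_nth. Qed.

Lemma sumn_removal {nu mu : seq nat} :
  is_part nu -> mu \in box_removals nu -> sumn nu = (sumn mu).+1.
Proof.
move=> pnu /mem_removalsP[i ri ->]; have [_ e] := remove_boxK pnu ri.
by rewrite -{1}e sumn_incr_nth.
Qed.

Lemma mem_additions_removals (nu mu : seq nat) :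
  is_part nu -> is_part mu -> (mu \in box_additions nu) = (nu \in box_removals mu).
Proof.
move=> pnu pmu; apply/mem_additionsP/mem_removalsP => // -[i hi ->]; exists i => //.
- by have [] := incr_nthK pnu hi.
- by have [_ ->] := incr_nthK pnu hi.
- by have [] := remove_boxK pmu hi.
- by have [_ ->] := remove_boxK pmu hi.
Qed.

Lemma box_additions_uniq (nu : seq nat) : is_part nu -> uniq (box_additions nu).
Proof.
move=> pnu; rewrite box_additionsE // map_inj_uniq ?filter_uniq ?iota_uniq //.
move=> i j /(congr1 (fun s => nth 0 s i)).
by rewrite !nth_incr_nth eqxx; case: (eqVneq j i) => // _; lia.
Qed.

Lemma box_removals_uniq (nu : seq nat) : is_part nu -> uniq (box_removals nu).
Proof.
move=> pnu; rewrite box_removalsE map_inj_in_uniq ?filter_uniq ?iota_uniq //.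
move=> i j; rewrite !mem_filter => /andP[ri _] /andP[rj _].
move=> /(congr1 (fun s => nth 0 s i)); rewrite !nth_remove_box // eqxx.
by rewrite /removable in ri; case: (eqVneq j i) => // _; lia.
Qed.

(** A common bound [M] indexes the additions and removals of partitions of different sizes by the
    same rows, so that double sums can be exchanged and compared term by term. *)
Lemma big_additions (nu : seq nat) (M : nat) (F : seq nat -> nat) :
  is_part nu -> size nu < M ->
  \sum_(mu <- box_additions nu) F mu
  = \sum_(i < M) if addable nu i then F (incr_nth nu i) else 0.
Proof.
move=> pnu hM; rewrite box_additionsE // big_map big_filter.
rewrite -(big_mkord xpredT (fun i => if addable nu i then F (incr_nth nu i) else 0)).
rewrite (big_cat_nat (n := (size nu).+1)) //= [X in _ + X]big_nat_cond [X in _ + X]big1.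
  by rewrite addn0 -big_mkcond /index_iota subn0.
move=> i /andP[/andP[hi _] _]; case: ifP => // /(addable_leq_size pnu); lia.
Qed.

Lemma big_removals (nu : seq nat) (M : nat) (F : seq nat -> nat) :
  size nu <= M ->
  \sum_(mu <- box_removals nu) F mu
  = \sum_(i < M) if removable nu i then F (remove_box nu i) else 0.
Proof.
move=> hM; rewrite box_removalsE // big_map big_filter.
rewrite -(big_mkord xpredT (fun i => if removable nu i then F (remove_box nu i) else 0)).
rewrite (big_cat_nat (n := size nu)) //= [X in _ + X]big_nat_cond [X in _ + X]big1.
  by rewrite addn0 -big_mkcond /index_iota subn0.
move=> i /andP[/andP[hi _] _]; case: ifP => // /removable_lt_size; lia.
Qed.

(* Addable rows are row 0 and the rows just below a corner. *)
Lemma sum_addable (nu : seq nat) (M c : nat) : size nu < M ->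
  \sum_(i < M) (if addable nu i then c else 0)
  = c + \sum_(i < M) if removable nu i then c else 0.
Proof.
case: M => // M; rewrite ltnS => hM; rewrite big_ord_recl /=; congr addn.
rewrite [RHS]big_ord_recr /= {2}/removable (@nth_default _ 0 nu M.+1) ?leqW //.
by rewrite (nth_default 0 hM) ltnn addn0.
Qed.

Lemma sum_off_diag (M : nat) (F : 'I_M -> 'I_M -> nat) :
  \sum_(i < M) \sum_(j < M) F i j
  = \sum_(i < M) F i i + \sum_(i < M) \sum_(j < M) if i != j then F i j else 0.
Proof.
rewrite -big_split /=; apply: eq_bigr => i _; rewrite (bigD1 i) //=; congr addn.
by rewrite -big_mkcond /=; apply: eq_bigl => j; rewrite eq_sym.
Qed.

(** The two moves interact only when [i = j.+1]; both sides then say that row [j] exceeds row [i] by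
    at least 2. *)
Lemma move_box {nu : seq nat} {i j : nat} : is_part nu -> i != j ->
  addable nu i && removable (incr_nth nu i) j
  = removable nu j && addable (remove_box nu j) i.
Proof.
move=> pnu ij; case rj: (removable nu j); last first.
  apply/negP => /andP[_]; move/negbT: rj.
  by rewrite /removable !nth_incr_nth (negbTE ij) add0n; lia.
rewrite /addable /= !nth_remove_box //.
move: rj; rewrite /removable !nth_incr_nth (negbTE ij) add0n => rj.
rewrite (eq_sym j i) (negbTE ij) subn0.
case: (eqVneq i 0) ij => [-> /= |i0 ij /=]; first by lia.
have -> : (j == i.-1) = (i == j.+1) by lia.
case: (eqVneq i j.+1) => [e|_]; last by lia.
by rewrite e /= in rj *; lia.
Qed.

(** Commutation of the up and down operators of Young's lattice. Moves in distinct rows commute by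
    [move_box]. Moves in the same row give [nu] back, once per addable row on the left and once per
    removable row on the right, and [sum_addable] accounts for the one extra copy. *)
Lemma sum_additions_removals (nu : seq nat) (F : seq nat -> nat) : is_part nu ->
  \sum_(mu <- box_additions nu) \sum_(rho <- box_removals mu) F rho
  = F nu + \sum_(mu <- box_removals nu) \sum_(rho <- box_additions mu) F rho.
Proof.
move=> pnu; set M := (size nu).+2.
rewrite (@big_additions nu M) // (@big_removals nu M); last by rewrite /M; lia.
pose A (i j : 'I_M) := if addable nu i && removable (incr_nth nu i) j
  then F (remove_box (incr_nth nu i) j) else 0.
pose B (i j : 'I_M) := if removable nu j && addable (remove_box nu j) i
  then F (incr_nth (remove_box nu j) i) else 0.
transitivity (\sum_(i < M) \sum_(j < M) A i j).
  apply: eq_bigr => i _; rewrite /A; case: ifP => ai; last by rewrite big1.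
  apply: big_removals; rewrite size_incr_nth /M.
  by case: ifP => _; rewrite ?ltnS leqW // (addable_leq_size pnu).
transitivity (F nu + \sum_(i < M) \sum_(j < M) B i j); last first.
  rewrite exchange_big; congr addn; apply: eq_bigr => j _ /=; rewrite /B.
  case: ifP => rj; last by rewrite big1.
  symmetry; apply: big_additions; first exact: is_part_remove_box.
  by rewrite /M ltnS ltnW // ltnS size_remove_box.
rewrite (sum_off_diag M A) (sum_off_diag M B) addnA; congr addn.
  have -> : \sum_(i < M) A i i = \sum_(i < M) if addable nu i then F nu else 0.
    apply: eq_bigr => i _; rewrite /A; case: ifP => [/andP[ai _]|].
      by rewrite ai; have [_ ->] := incr_nthK pnu ai.
    by case: ifP => // ai; have [-> _] := incr_nthK pnu ai.
  have -> : \sum_(i < M) B i i = \sum_(i < M) if removable nu i then F nu else 0.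
    apply: eq_bigr => i _; rewrite /B; case: ifP => [/andP[ri _]|].
      by rewrite ri; have [_ ->] := remove_boxK pnu ri.
    by case: ifP => // ri; have [-> _] := remove_boxK pnu ri.
  exact: sum_addable.
apply: eq_bigr => i _; apply: eq_bigr => j _; case: ifP => // ij.
rewrite /A /B -move_box //; case: ifP => // /andP[ai rj].
congr F; have pi : is_part (incr_nth nu i) by rewrite is_part_incr_nth.
have /andP[rj' ai'] : removable nu j && addable (remove_box nu j) i.
  by rewrite -move_box // ai.
have pr := is_part_remove_box pnu rj'.
apply: part_eq; [exact: is_part_remove_box|by rewrite is_part_incr_nth|].
move=> l; rewrite nth_remove_box // !nth_incr_nth nth_remove_box //.
(* Subtraction truncates at 0: row [j] of [nu] has a box and differs from row [i], so the box taken
   from row [j] is a genuine one in either order. *)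
have : (nth 0 nu l > 0) || (j != l :> nat).
  case: (eqVneq (j : nat) l) => [<-|_]; last by rewrite orbT.
  by rewrite orbF; move: rj'; rewrite /removable; lia.
have : ~~ ((i == l :> nat) && (j == l :> nat)).
  by apply: contra ij => /andP[/eqP e1 /eqP e2]; apply/eqP/val_inj; rewrite /= e1 e2.
by case: (i == l :> nat); case: (j == l :> nat) => //=; lia.
Qed.

(** * Standard Young tableaux *)

(** Out of range, [nth] returns the empty row, which satisfies the row and column conditions
    vacuously; the indices can thus range over all of [nat]. *)
Lemma is_sytP (mu : seq nat) (t : seq (seq nat)) :
  reflect [/\ shape t = mu, perm_eq (flatten t) (iota 1 (sumn mu)),
    forall i, sorted ltn (nth [::] t i)
    & forall i j, j < size (nth [::] t i.+1) ->
        nth 0 (nth [::] t i) j < nth 0 (nth [::] t i.+1) j]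
  (is_syt mu t).
Proof.
apply: (iffP and4P) => -[h1 h2 h3 h4].
  split=> //; first exact/eqP.
    move=> i; case: (ltnP i (size t)) => hi; last by rewrite nth_default.
    by apply: (allP h3); exact: mem_nth.
  move=> i j hj; have hi : i < (size t).-1.
    case: (ltnP i.+1 (size t)) hj => [|hi]; first by case: (size t).
    by rewrite nth_default.
  have it : i \in iota 0 (size t).-1 by rewrite mem_iota.
  by apply: (allP (allP h4 i it)); rewrite mem_iota.
split=> //; first exact/eqP.
  by apply/allP => r /(nthP [::]) [i _ <-].
apply/allP => i _; apply/allP => j; rewrite mem_iota => /andP[_ hj].
exact: h4.
Qed.

Lemma nth_shape_syt {mu : seq nat} {t : seq (seq nat)} (i : nat) :
  is_syt mu t -> size (nth [::] t i) = nth 0 mu i.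
Proof. by case/is_sytP => <- _ _ _; rewrite nth_shape. Qed.

Lemma syt_entry {mu : seq nat} {t : seq (seq nat)} {i x : nat} :
  is_syt mu t -> x \in nth [::] t i -> 0 < x <= sumn mu.
Proof.
case/is_sytP => _ hp _ _ hx.
have : x \in iota 1 (sumn mu).
  rewrite -(perm_mem hp); apply/flattenP; exists (nth [::] t i) => //.
  by apply: mem_nth; case: (ltnP i (size t)) hx => // hi; rewrite nth_default.
by rewrite mem_iota add1n ltnS.
Qed.

Lemma syt_nonnil {mu : seq nat} {t : seq (seq nat)} :
  is_part mu -> is_syt mu t -> [::] \notin t.
Proof.
move=> /is_partP[h _] /is_sytP[e _ _ _]; apply: contraNN h => h.
by rewrite -e; apply/mapP; exists [::].
Qed.

Definition syts (mu : seq nat) : seq (seq (seq nat)) :=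
  [seq t <- [seq reshape mu w | w <- permutations (iota 1 (sumn mu))] | is_syt mu t].

Lemma nb_sytE (mu : seq nat) : nb_syt mu = size (syts mu).
Proof. by rewrite size_filter. Qed.

Lemma mem_syts (mu : seq nat) (t : seq (seq nat)) : (t \in syts mu) = is_syt mu t.
Proof.
rewrite mem_filter; case: (boolP (is_syt mu t)) => //= /is_sytP[h1 h2 _ _].
by apply/mapP; exists (flatten t); rewrite -?h1 ?flattenK // h1 mem_permutations.
Qed.

Lemma syts_uniq (mu : seq nat) : uniq (syts mu).
Proof.
apply: filter_uniq; rewrite map_inj_in_uniq ?permutations_uniq //.
move=> v w; rewrite !mem_permutations => /perm_size hv /perm_size hw.
by move/(congr1 flatten); rewrite !reshapeKr // ?hv ?hw size_iota.
Qed.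

(** At [j = size t] this opens a new row containing only [n]. *)
Definition add_entry (j n : nat) (t : seq (seq nat)) : seq (seq nat) :=
  set_nth [::] t j (rcons (nth [::] t j) n).

Lemma nth_add_entry (j n i : nat) (t : seq (seq nat)) :
  nth [::] (add_entry j n t) i
  = if i == j then rcons (nth [::] t j) n else nth [::] t i.
Proof. exact: nth_set_nth. Qed.

Lemma shape_add_entry (j n : nat) (t : seq (seq nat)) :
  shape (add_entry j n t) = incr_nth (shape t) j.
Proof.
rewrite /add_entry; elim: t j => [|r t IH] [|j] //=.
- by congr cons; elim: j => //= j ->.
- by rewrite size_rcons.
by rewrite IH.
Qed.

Lemma perm_flatten_add_entry (j n : nat) (t : seq (seq nat)) :
  perm_eq (flatten (add_entry j n t)) (n :: flatten t).
Proof.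
rewrite /add_entry; elim: t j => [|r t IH] [|j] //=.
- by elim: j => //= j; case: j.
- by rewrite cat_rcons -cat1s -(cat1s n (r ++ _)) perm_catCA.
rewrite (@perm_trans _ (r ++ n :: flatten t)) ?perm_cat2l ?IH //.
by rewrite -cat1s -(cat1s n (r ++ _)) perm_catCA.
Qed.

Lemma nth_nth_add_entry (j n i c : nat) (t : seq (seq nat)) :
  c < size (nth [::] t i) ->
  nth 0 (nth [::] (add_entry j n t) i) c = nth 0 (nth [::] t i) c.
Proof.
by move=> hc; rewrite nth_add_entry; case: eqP => // <-; rewrite nth_rcons hc.
Qed.

Lemma perm_iota_rcons (n : nat) : perm_eq (n.+1 :: iota 1 n) (iota 1 n.+1).
Proof. by rewrite -addn1 iotaD add1n addn1 perm_sym cats1 perm_rcons. Qed.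

Lemma sorted_ltn_rcons (r : seq nat) (n : nat) :
  sorted ltn (rcons r n) = all (ltn^~ n) r && sorted ltn r.
Proof. by rewrite !(sorted_pairwise ltn_trans) pairwise_rcons. Qed.

Lemma syt_add_entry {mu : seq nat} {j : nat} {t : seq (seq nat)} :
  is_part mu -> addable mu j -> is_syt mu t ->
  is_syt (incr_nth mu j) (add_entry j (sumn mu).+1 t).
Proof.
move=> pmu aj st; case/is_sytP: (st) => h1 h2 h3 h4.
have lt_n i x : x \in nth [::] t i -> x < (sumn mu).+1.
  by move=> /(syt_entry st) /andP[].
apply/is_sytP; split.
- by rewrite shape_add_entry h1.
- rewrite (permPl (perm_flatten_add_entry _ _ _)) sumn_incr_nth.
  by rewrite -(permPr (perm_iota_rcons _)) perm_cons.
- move=> i; rewrite nth_add_entry; case: eqP => // _.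
  by rewrite sorted_ltn_rcons h3 andbT; apply/allP => x /lt_n.
move=> i c; rewrite !nth_add_entry.
have up k : c < size (nth [::] t k.+1) -> c < size (nth [::] t k).
  by rewrite !(nth_shape_syt _ st) => hc; exact: leq_trans hc (part_nthS _ _).
(* When the new entry lies in the lower row, addability provides the cell above it, whose entry is
   an older and hence smaller one. *)
case: (eqVneq i.+1 j) aj => [<-|ij] aj.
  rewrite (ltn_eqF (ltnSn i)) size_rcons ltnS leq_eqVlt nth_rcons.
  case: ltnP => [hc _|hc]; first exact: h4.
  rewrite orbF => e; rewrite e; apply: (lt_n i); apply: mem_nth.
  by move: aj; rewrite /addable /= (eqP e) !(nth_shape_syt _ st).
move=> hc; case: eqP => [e|_]; last exact: h4.
by rewrite -e nth_rcons up //; exact: h4.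
Qed.

(** Rows increase, so the largest entry ends its row; columns increase, so nothing lies below it. It
    therefore occupies a corner, and deleting it leaves a standard tableau. *)
Lemma syt_remove_entry {nu : seq nat} {t : seq (seq nat)} :
  is_part nu -> is_syt nu t -> 0 < sumn nu ->
  exists j t', [/\ removable nu j, is_syt (remove_box nu j) t'
                 & t = add_entry j (sumn nu) t'].
Proof.
move=> pnu st n0; case/is_sytP: (st) => h1 h2 h3 h4; set n := sumn nu.
have /flattenP[r rt nr] : n \in flatten t.
  by rewrite (perm_mem h2) mem_iota n0 /= add1n.
have /(nthP [::])[j jt rE] := rt.
have [r' r'E] : exists r', nth [::] t j = rcons r' n.
  have := h3 j; have := @syt_entry _ _ j ^~ st; rewrite rE.
  case/lastP: r nr {rt rE} => // r' y nr /(_ y); rewrite mem_rcons mem_head.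
  move=> /(_ isT) /andP[_ yn]; rewrite sorted_ltn_rcons => /andP[/allP h _].
  move: nr; rewrite mem_rcons inE => /orP[/eqP ->|/h]; first by exists r'.
  by rewrite /= ltnNge yn.
have rj : removable nu j.
  (* A next row at least as long would have an entry under [n], larger than [n]. *)
  rewrite /removable ltnNge; apply/negP => hj.
  have hc : size r' < size (nth [::] t j.+1).
    rewrite (nth_shape_syt _ st) (leq_trans _ hj) // -(nth_shape_syt _ st) r'E.
    by rewrite size_rcons.
  have := h4 j (size r') hc; rewrite r'E nth_rcons ltnn eqxx.
  by have /andP[_] := syt_entry st (mem_nth 0 hc); rewrite leqNgt => /negP.
have tn := syt_nonnil pnu st.
have [t' t'n tE] : exists2 t', [::] \notin t' & t = add_entry j n t'.
  (* If [n] is alone in row [j], the corner condition makes this the last row and it is dropped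
     altogether; otherwise the row is shortened to [r']. Either way no empty row remains. *)
  case: (eqVneq r' [::]) => [r0|r0].
    exists (take j t); first by apply: contra tn; exact: mem_take.
    have szj : size (take j t) = j by rewrite size_takel // ltnW.
    have szt : size t = j.+1.
      apply/eqP; rewrite eqn_leq jt andbT -(size_map size t) -/(shape t) h1 leqNgt.
      rewrite -(part_nth_gt0 _ pnu) -leqNgt -ltnS; apply: (leq_trans rj).
      by rewrite -(nth_shape_syt j st) r'E r0.
    rewrite /add_entry (nth_default _ (eq_leq szj)).
    apply: (@eq_from_nth _ [::]) => [|i].
      by rewrite size_set_nth szj szt (maxn_idPl (leqnSn _)).
    rewrite szt ltnS leq_eqVlt nth_set_nth /=.
    by case: eqP => [-> _|_ /= hi]; rewrite ?r'E ?r0 // nth_take.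
  exists (set_nth [::] t j r').
    apply/negP => /(nthP [::]) [i]; rewrite size_set_nth (maxn_idPr jt) nth_set_nth /=.
    case: eqP => [_ _ e|_ hi e]; first by rewrite e eqxx in r0.
    by rewrite -e mem_nth in tn.
  rewrite /add_entry nth_set_nth /= eqxx -r'E.
  apply: (@eq_from_nth _ [::]) => [|i hi].
    by rewrite !size_set_nth !(maxn_idPr jt).
  rewrite nth_set_nth /=; case: (i =P j) => [->//|/eqP ij].
  by rewrite nth_set_nth /= (negbTE ij).
exists j, t'; split=> //.
have e1 : incr_nth (shape t') j = nu by rewrite -(shape_add_entry j n) -tE.
have pr := is_part_remove_box pnu rj.
have e2 : shape t' = remove_box nu j.
  apply: (@eq_nth_notin _ 0) => [||i].
  - by apply: contra t'n => /mapP[[|//] hr _].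
  - by case/is_partP: pr.
  by rewrite nth_remove_box // -e1 nth_incr_nth addKn.
have en : n = (sumn (remove_box nu j)).+1 by rewrite -e2 -(sumn_incr_nth _ j) e1.
apply/is_sytP; split=> //.
- rewrite -(perm_cons n) -(permPl (perm_flatten_add_entry j n t')) -tE.
  by rewrite (perm_trans h2) // -/n en perm_sym perm_iota_rcons.
- move=> i; have := h3 i; rewrite tE nth_add_entry; case: eqP => // ->.
  by rewrite sorted_ltn_rcons => /andP[].
move=> i c hc; have hc' : c < size (nth [::] t' i).
  by move: hc; rewrite -!nth_shape e2 => hc; exact: leq_trans hc (part_nthS _ _).
have := h4 i c; rewrite tE !nth_nth_add_entry //; apply.
by rewrite nth_add_entry; case: eqP => // <-; rewrite size_rcons ltnW.
Qed.

(** The row containing [n] gives [i = j]; deleting [n] from it recovers every row, and [nth]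
    determines lists without empty rows. *)
Lemma add_entry_inj {n i j : nat} {t u : seq (seq nat)} :
  (forall l, n \notin nth [::] t l) -> (forall l, n \notin nth [::] u l) ->
  [::] \notin t -> [::] \notin u ->
  add_entry i n t = add_entry j n u -> i = j /\ t = u.
Proof.
move=> nt nu t0 u0 e.
have eij : i = j.
  have := congr1 (fun s => nth [::] s i) e; rewrite !nth_add_entry eqxx.
  by case: eqP => // _ e'; have := nu i; rewrite -e' mem_rcons mem_head.
split=> //; apply: eq_nth_notin t0 u0 _ => l.
have := congr1 (fun s => nth [::] s l) e; rewrite !nth_add_entry -eij.
by case: eqP => // ->; exact: rcons_injl.
Qed.

(* The largest entry of a standard tableau sits in a corner. *)
Lemma nb_syt_branching {nu : seq nat} : is_part nu -> 0 < sumn nu ->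
  nb_syt nu = \sum_(mu <- box_removals nu) nb_syt mu.
Proof.
move=> pnu n0; set C := [seq j <- iota 0 (size nu) | removable nu j].
have memC j : j \in C -> removable nu j by rewrite mem_filter => /andP[].
pose S := [seq add_entry j (sumn nu) t | j <- C, t <- syts (remove_box nu j)].
have nE j : removable nu j -> sumn nu = (sumn (remove_box nu j)).+1.
  by move=> rj; have [_ {1}<-] := remove_boxK pnu rj; rewrite sumn_incr_nth.
have /perm_size : perm_eq (syts nu) S.
  apply: uniq_perm; first exact: syts_uniq.
    apply: allpairs_uniq_dep => [|j _|]; first by rewrite filter_uniq ?iota_uniq.
      exact: syts_uniq.
    move=> p q /allpairsPdep[i [t [/memC ri + ->]]].
    move=> + /allpairsPdep[j [u [/memC rj + ->]]] /=; rewrite !mem_syts => st su.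
    have pi := is_part_remove_box pnu ri; have pj := is_part_remove_box pnu rj.
    case/add_entry_inj => [l|l|||-> -> //].
    - by apply/negP => /(syt_entry st); rewrite (nE _ ri) ltnn.
    - by apply/negP => /(syt_entry su); rewrite (nE _ rj) ltnn.
    - exact: syt_nonnil st.
    - exact: syt_nonnil su.
  move=> t; rewrite mem_syts; apply/idP/allpairsPdep => [st|].
    have [j [u [rj su ->]]] := syt_remove_entry pnu st n0.
    exists j, u; rewrite mem_syts su mem_filter rj mem_iota.
    by split=> //; exact: removable_lt_size rj.
  move=> [j [u [/memC rj]]]; rewrite mem_syts => su ->.
  have [aj {1}<-] := remove_boxK pnu rj; rewrite (nE _ rj).
  exact: syt_add_entry (is_part_remove_box pnu rj) aj su.
rewrite -nb_sytE => ->; rewrite size_allpairs_dep sumnE !big_map.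
by apply: eq_bigr => j _; rewrite nb_sytE.
Qed.

Lemma part_sumn_eq0 {nu : seq nat} : is_part nu -> (sumn nu == 0) = (nu == [::]).
Proof.
move=> /is_partP[h _]; case: nu h => //= a l; rewrite inE negb_or addn_eq0.
by case: a.
Qed.

(** The last row of a nonempty partition always ends in a corner, so the branching sum has a term
    that is positive by induction on the area. *)
Lemma nb_syt_gt0 {nu : seq nat} : is_part nu -> 0 < nb_syt nu.
Proof.
move: {2}(sumn nu) (erefl (sumn nu)) => n; elim: n nu => [|n IH] nu en pnu.
  by have /eqP -> : nu == [::]; rewrite -?part_sumn_eq0 ?en.
rewrite nb_syt_branching ?en //.
have s0 : 0 < size nu by case: nu en {pnu}.
have rj : removable nu (size nu).-1.
  by rewrite /removable prednK // nth_default // part_nth_gt0 // prednK.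
have hmu : remove_box nu (size nu).-1 \in box_removals nu.
  by apply/mem_removalsP; exists (size nu).-1.
rewrite (big_rem _ hmu) /= ltn_addr // IH ?is_part_remove_box //.
by have := sumn_removal pnu hmu; rewrite en => -[].
Qed.

(** The boolean factor covers the empty partition, which has one tableau but no removal. *)
Lemma sum_nb_syt_removals {nu : seq nat} : is_part nu ->
  \sum_(mu <- box_removals nu) nb_syt mu = (0 < sumn nu) * nb_syt nu.
Proof.
move=> pnu; case: posnP => [/eqP|n0]; last by rewrite mul1n -nb_syt_branching.
by rewrite part_sumn_eq0 // => /eqP ->; rewrite /box_removals /= big_nil.
Qed.

Lemma sum_nb_syt_additions {nu : seq nat} : is_part nu ->
  \sum_(mu <- box_additions nu) nb_syt mu = (sumn nu).+1 * nb_syt nu.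
Proof.
move: {2}(sumn nu) (erefl (sumn nu)) => n; elim/ltn_ind: n nu => n IH nu en pnu.
transitivity (\sum_(mu <- box_additions nu) \sum_(rho <- box_removals mu) nb_syt rho).
  apply: eq_big_seq => mu hmu; rewrite -nb_syt_branching ?(sumn_addition pnu hmu) //.
  exact: is_part_addition hmu.
rewrite sum_additions_removals // mulSn; congr addn.
(* By induction a removal [mu] contributes [(sumn mu).+1] times its own count, and [(sumn mu).+1] is
   [sumn nu]. *)
transitivity (\sum_(mu <- box_removals nu) sumn nu * nb_syt mu).
  apply: eq_big_seq => mu hmu; have e := sumn_removal pnu hmu.
  rewrite (IH (sumn mu)) ?e // -?en ?e //; exact: is_part_removal hmu.
rewrite -big_distrr sum_nb_syt_removals //=.
by case: (sumn nu) => // m; rewrite mul1n.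
Qed.

(** * Counting oscillating tableaux *)

(* The number of oscillating tableaux of length [m] and of shape [mu] is
   [nb_paths m (sumn mu) * nb_syt mu]; see [size_oscs]. *)
Fixpoint nb_paths (m Y : nat) : nat :=
  if m is m'.+1 then
    (if Y is Y'.+1 then nb_paths m' Y' else 0) + Y.+1 * nb_paths m' Y.+1
  else Y == 0.

Lemma nb_pathsS (m Y : nat) : nb_paths m.+1 Y
  = (if Y is Y'.+1 then nb_paths m Y' else 0) + Y.+1 * nb_paths m Y.+1.
Proof. by []. Qed.

(** Expand [nb_paths m.+2 Y.+1]. The induction hypothesis at [Y.+1] and at [Y.-1] turns everything
    except one copy of [nb_paths m.+1 Y] into [m.+1] times the recurrence for that same number. *)
Lemma nb_paths_removal (m Y : nat) :
  m.+1 * nb_paths m Y = Y.+1 * nb_paths m.+1 Y.+1.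
Proof.
elim: m Y => [|m IH] Y; first by rewrite /=; case: Y => //= Y; rewrite !muln0.
(* This is the induction hypothesis at [Y.-1], extended to [Y = 0], where both sides vanish. *)
have e2 : Y * nb_paths m.+1 Y = m.+1 * if Y is Y'.+1 then nb_paths m Y' else 0.
  by case: Y => [|Y]; rewrite ?muln0 // IH.
rewrite [nb_paths m.+2 _]nb_pathsS mulnDr -IH mulSn (mulSn Y) e2 -addnA.
by congr addn; rewrite nb_pathsS mulnDr; congr addn; rewrite mulnCA.
Qed.

(** For [k > 0] the last step can come from area [k.-1]; for [k = 0] and positive length it comes
    from area 1, at length [1 + 2 * n]. The form [k + 2 * n] of the length enters here. *)
Lemma nb_paths_gt0 (k n : nat) : 0 < nb_paths (k + 2 * n) k.
Proof.
elim: n k => [|n IHn]; elim=> [|k IHk] //; try by rewrite addSn nb_pathsS ltn_addr.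
have := IHn 1; rewrite add0n add1n mulnS /= => h.
by rewrite add0n mul1n.
Qed.

(** Box steps between partitions are reversible, so these are also the possible predecessors of
    [mu]. *)
Definition neighbors (mu : seq nat) : seq (seq nat) :=
  box_removals mu ++ box_additions mu.

Lemma neighbors_uniq (mu : seq nat) : is_part mu -> uniq (neighbors mu).
Proof.
move=> pmu; rewrite cat_uniq box_removals_uniq // box_additions_uniq // andbT.
apply/hasPn => nu /(sumn_addition pmu) ha; apply/negP => /(sumn_removal pmu); lia.
Qed.

Lemma neighborsP {mu nu : seq nat} : is_part mu ->
  (nu \in neighbors mu) = is_part nu && box_step nu mu.
Proof.
move=> pmu; rewrite /neighbors /box_step mem_cat.
apply/orP/andP => [[h|h]|[pnu /orP[h|h]]].
- have pnu := is_part_removal pmu h; by rewrite mem_additions_removals // h.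
- have pnu := is_part_addition pmu h; rewrite -(mem_additions_removals mu) //.
  by rewrite h orbT.
- by left; rewrite -mem_additions_removals.
- by right; rewrite mem_additions_removals.
Qed.

(** The recursion peels off the last partition, in the order in which the algorithm builds its
    output. *)
Fixpoint oscs (m : nat) (mu : seq nat) : seq (seq (seq nat)) :=
  if m is m'.+1 then [seq rcons V mu | nu <- neighbors mu, V <- oscs m' nu]
  else if mu == [::] then [:: [:: mu]] else [::].

Lemma mem_oscs (m : nat) (mu : seq nat) (T : seq (seq nat)) :
  is_part mu -> (T \in oscs m mu) = osc_tableau m mu T.
Proof.
elim: m mu T => [|m IH] mu T pmu.
  rewrite /= /osc_tableau; case: eqVneq => [-> | mu0].
    by case: T => [|[|a x] [|y T]] //=; rewrite inE /= ?andbF.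
  case: T => [|x [|y T]] //=; rewrite andbT; case: (eqVneq x [::]) => [-> |].
    by rewrite eq_sym (negbTE mu0) andbF.
  by rewrite andbF.
apply/allpairsPdep/idP => [[nu [V [hnu + ->]]]|].
  have /andP[pnu st] : is_part nu && box_step nu mu by rewrite -neighborsP.
  rewrite IH // => /and5P[/eqP sS aS hS /eqP lS oS].
  apply/and5P; split; rewrite ?size_rcons ?sS ?all_rcons ?pmu ?last_rcons //.
    by case: (V) sS hS.
  case: (V) sS lS oS => //= x V' _ lS oS.
  by rewrite rcons_path oS lS.
case/lastP: T => [|V x] /and5P[] //.
rewrite size_rcons all_rcons last_rcons => /eqP[sS] /andP[_ aS] hS /eqP xE oS.
subst x; exists (last [::] V), V; split=> //.
  rewrite neighborsP // (allP aS) /=; last first.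
    by case: (V) sS => //= a l _; exact: mem_last.
  by case: (V) oS sS => //= a l; rewrite rcons_path => /andP[].
rewrite IH; last by apply: (allP aS); case: (V) sS => //= a l _; exact: mem_last.
apply/and5P; split=> //; first exact/eqP.
  by case: (V) sS hS.
by case: (V) oS sS => //= a l; rewrite rcons_path => /andP[].
Qed.

Lemma last_oscs {m : nat} {mu : seq nat} {T : seq (seq nat)} :
  is_part mu -> T \in oscs m mu -> size T = m.+1 /\ last [::] T = mu.
Proof. by move=> pmu; rewrite mem_oscs // => /and5P[/eqP ? _ _ /eqP ? _]. Qed.

Lemma is_part_neighbor {mu nu : seq nat} :
  is_part mu -> nu \in neighbors mu -> is_part nu.
Proof. by move=> pmu; rewrite neighborsP // => /andP[]. Qed.

Lemma oscs_uniq (m : nat) (mu : seq nat) : is_part mu -> uniq (oscs m mu).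
Proof.
elim: m mu => [|m IH] mu pmu /=; first by case: ifP.
apply: allpairs_uniq_dep; first exact: neighbors_uniq.
  by move=> nu /(is_part_neighbor pmu); exact: IH.
move=> p q /allpairsPdep[nu [V [hnu hS ->]]] /allpairsPdep[rho [U [hrho hU ->]]] /=.
move=> e0; have e : V = U by apply: rcons_injl e0.
rewrite -{}e {e0} in hU *.
have [_ <-] := last_oscs (is_part_neighbor pmu hnu) hS.
by have [_ <-] := last_oscs (is_part_neighbor pmu hrho) hU.
Qed.

Lemma count_oscsS (m : nat) (mu : seq nat) (E : pred (seq (seq nat))) :
  count E (oscs m.+1 mu)
  = \sum_(nu <- box_removals mu) count (fun V => E (rcons V mu)) (oscs m nu)
  + \sum_(nu <- box_additions mu) count (fun V => E (rcons V mu)) (oscs m nu).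
Proof.
rewrite -big_cat /= count_flatten sumnE !big_map.
by apply: eq_bigr => nu _; rewrite count_map.
Qed.

(** Classify by the next-to-last partition: [nb_paths] is constant on the removals and on the
    additions, leaving the two sums of [nb_syt] already computed. *)
Lemma size_oscs (m : nat) (mu : seq nat) :
  is_part mu -> size (oscs m mu) = nb_paths m (sumn mu) * nb_syt mu.
Proof.
elim: m mu => [|m IH] mu pmu.
  by rewrite /= part_sumn_eq0 //; case: eqP => // ->.
rewrite -(count_predT (oscs _ _)) count_oscsS nb_pathsS mulnDl; congr addn.
  transitivity (\sum_(nu <- box_removals mu) nb_paths m (sumn mu).-1 * nb_syt nu).
    apply: eq_big_seq => nu hnu; rewrite count_predT IH ?(is_part_removal pmu) //.
    by rewrite (sumn_removal pmu hnu).
  rewrite -big_distrr /= sum_nb_syt_removals //.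
  by case: (sumn mu) => [|Y]; rewrite ?mul0n ?muln0 ?mul1n.
transitivity (\sum_(nu <- box_additions mu) nb_paths m (sumn mu).+1 * nb_syt nu).
  apply: eq_big_seq => nu hnu; rewrite count_predT IH ?(is_part_addition pmu) //.
  by rewrite (sumn_addition pmu hnu).
by rewrite -big_distrr /= sum_nb_syt_additions // mulnCA mulnA.
Qed.

(** Cutting at index [m] leaves an arbitrary oscillating tableau ending at the current partition.
    That partition is shared with [h], hence the [behead]. *)
Lemma oscs_history {m X : nat} {la : seq nat} {T0 : seq (seq nat)} :
  is_part la -> T0 \in oscs (m + X) la ->
  let h := drop m T0 in
  is_part (head [::] h) /\
  perm_eq [seq T <- oscs (m + X) la | drop m T == h]
          [seq V ++ behead h | V <- oscs m (head [::] h)].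
Proof.
move=> pla hT0 h; move: (hT0); rewrite mem_oscs //.
move=> /and5P[/eqP sT0 aT0 _ /eqP lT0 oT0].
set mu := head [::] h; set b := behead h.
have hE : h = mu :: b.
  by rewrite /mu /b /h (drop_nth [::]) // sT0 ltnS leq_addr.
have ah : all is_part h by apply/allP => x /mem_drop; exact: (allP aT0).
have oh : sorted box_step h by exact: drop_sorted.
have pmu : is_part mu by move: ah; rewrite hE => /andP[].
split=> //; apply: uniq_perm.
- by rewrite filter_uniq ?oscs_uniq.
- rewrite map_inj_in_uniq ?oscs_uniq // => V U /(last_oscs pmu)[sS _].
  move=> /(last_oscs pmu)[sU _] /eqP; rewrite eqseq_cat ?sS ?sU //.
  by case/andP => /eqP.
move=> T; rewrite mem_filter mem_oscs //; apply/andP/mapP.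
  move=> [/eqP dT /and5P[/eqP sT aT hT lT oT]]; exists (take m.+1 T).
    rewrite mem_oscs //; apply/and5P; split.
    - by rewrite size_takel // sT ltnS leq_addr.
    - by apply/allP => x /mem_take; exact: (allP aT).
    - by case: (T) hT.
    - rewrite (take_nth [::]) ?sT ?ltnS ?leq_addr // last_rcons.
      by rewrite /mu -dT -nth0 nth_drop addn0.
    - exact: take_sorted.
  rewrite -{1}(cat_take_drop m.+1 T); congr cat.
  by rewrite /b -dT -drop1 drop_drop add1n.
move=> [V + ->]; rewrite mem_oscs // => /and5P[/eqP sS aS hS /eqP lS oS].
split.
  case/lastP: V sS lS {aS hS oS} => // V x; rewrite size_rcons last_rcons => -[sS] ->.
  by rewrite cat_rcons drop_size_cat // hE.
have sh : size h = X.+1 by rewrite /h size_drop sT0 -addnS addKn.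
apply/and5P; split.
- by rewrite size_cat sS size_behead sh addSn.
- by rewrite all_cat aS; move: ah; rewrite hE => /andP[].
- by case: (V) sS hS.
- rewrite last_cat lS -lT0 -(cat_take_drop m T0) -/h last_cat hE.
  by rewrite eqxx.
- case: (V) sS lS oS => //= x V' _ lS oS; rewrite cat_path oS lS.
  by move: oh; rewrite hE.
Qed.

(** * Laws of the sampling algorithm *)

Local Open Scope ring_scope.

Lemma Pr_ret (A : Type) (x : A) (E : pred A) : Pr (ret x) E = (E x)%:R.
Proof. by rewrite /Pr big_cons big_nil /=; case: (E x); rewrite ?addr0. Qed.

Lemma Pr_scale (A : Type) (a : rat) (d : dist A) (E : pred A) :
  Pr [seq (a * q.1, q.2) | q <- d] E = a * Pr d E.
Proof. by rewrite /Pr big_map big_distrr. Qed.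

Lemma Pr_choice (A : Type) (p : rat) (d1 d2 : dist A) (E : pred A) :
  Pr (choice p d1 d2) E = p * Pr d1 E + (1 - p) * Pr d2 E.
Proof. by rewrite -!Pr_scale /Pr big_cat. Qed.

Lemma Pr_bind (A B : Type) (d : dist A) (f : A -> dist B) (E : pred B) :
  Pr (bind d f) E = \sum_(p <- d) p.1 * Pr (f p.2) E.
Proof.
elim: d => [|p d IH]; first by rewrite /Pr !big_nil.
by rewrite big_cons -IH -Pr_scale /Pr -big_cat.
Qed.

Lemma Pr_dmap (A B : Type) (f : A -> B) (d : dist A) (E : pred B) :
  Pr (dmap f d) E = Pr d (E \o f).
Proof.
rewrite Pr_bind /Pr [RHS]big_mkcond; apply: eq_bigr => p _.
by rewrite -/(Pr _ _) Pr_ret /=; case: (E _); rewrite ?mulr1 ?mulr0.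
Qed.

Lemma Pr_unif (A : Type) (s : seq A) (E : pred A) :
  Pr (unif s) E = (count E s)%:R / (size s)%:R.
Proof.
rewrite /Pr /unif big_map /=; move: (_%:R^-1 : rat) => c.
elim: s => [|x s IH]; first by rewrite big_nil mul0r.
by rewrite big_cons /= natrD mulrDl -IH; case: (E x); rewrite ?mul1r ?mul0r ?add0r.
Qed.

Lemma Pr_hook_walk (B : Type) (mu : seq nat) (f : seq nat -> dist B) (E : pred B) :
  Pr (bind (hook_walk mu) f) E
  = \sum_(nu <- box_removals mu) (nb_syt nu)%:R / (nb_syt mu)%:R * Pr (f nu) E.
Proof. by rewrite Pr_bind big_map. Qed.

Lemma Pr_co_hook_walk (B : Type) (mu : seq nat) (f : seq nat -> dist B)
    (E : pred B) :
  Pr (bind (co_hook_walk mu) f) E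
  = \sum_(nu <- box_additions mu)
      (nb_syt nu)%:R / ((sumn mu).+1%:R * (nb_syt mu)%:R) * Pr (f nu) E.
Proof. by rewrite Pr_bind big_map. Qed.

Lemma Pr_sample_loopS (m N X Y : nat) (mu : seq nat) (T : seq (seq nat))
    (E : pred (seq (seq nat))) : (X < N)%N ->
  Pr (sample_loop m.+1 N X Y (mu :: T)) E
  = removal_prob N X Y * \sum_(nu <- box_removals mu)
      (nb_syt nu)%:R / (nb_syt mu)%:R
        * Pr (sample_loop m N X.+1 Y.-1 [:: nu, mu & T]) E
    + (1 - removal_prob N X Y) * \sum_(nu <- box_additions mu)
      (nb_syt nu)%:R / ((sumn mu).+1%:R * (nb_syt mu)%:R)
        * Pr (sample_loop m N X.+1 Y.+1 [:: nu, mu & T]) E.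
Proof. by move=> /= ->; rewrite Pr_choice Pr_hook_walk Pr_co_hook_walk. Qed.

Lemma removal_probE (X m Y : nat) :
  removal_prob (X + m.+1) X Y = Y%:R / m.+1%:R.
Proof. by rewrite /removal_prob natrD addrC addKr. Qed.

Lemma nb_syt_neq0 {mu : seq nat} : is_part mu -> (nb_syt mu)%:R != 0 :> rat.
Proof. by move=> pmu; rewrite pnatr_eq0 -lt0n nb_syt_gt0. Qed.

(** The removal branch leads to [nu] with its frequency among the tableaux counted. The product form
    also covers a count equal to 0. The identity behind it is [nb_paths_removal]. *)
Lemma removal_weight (m : nat) (mu : seq nat) (pmu : is_part mu) (nu : seq nat) :
  nu \in box_removals mu ->
  (size (oscs m.+1 mu))%:R * ((sumn mu)%:R / m.+1%:R)
    * ((nb_syt nu)%:R / (nb_syt mu)%:R)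
  = (size (oscs m nu))%:R :> rat.
Proof.
move=> hnu; have pnu := is_part_removal pmu hnu; rewrite !size_oscs //.
have mu0 := nb_syt_neq0 pmu.
have := nb_paths_removal m (sumn nu); rewrite (sumn_removal pmu hnu).
move=> /(congr1 (fun k : nat => k%:R : rat)); rewrite !natrM => e.
have m0 : m.+1%:R != 0 :> rat by rewrite pnatr_eq0.
apply: (mulfI m0); rewrite [RHS]mulrA e; field.
by rewrite mu0 [1 + _]addrC natr1 m0.
Qed.

(** By [e2], the fraction [Y / m.+1] of [nb_paths m.+1 Y] is the removal term of its recurrence. The
    complement is the addition term, whose factor [Y.+1] cancels the denominator of the
    complementary hook walk. *)
Lemma addition_weight (m : nat) (mu : seq nat) (pmu : is_part mu) (nu : seq nat) :
  nu \in box_additions mu ->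
  (size (oscs m.+1 mu))%:R * (1 - (sumn mu)%:R / m.+1%:R)
    * ((nb_syt nu)%:R / ((sumn mu).+1%:R * (nb_syt mu)%:R))
  = (size (oscs m nu))%:R :> rat.
Proof.
move=> hnu; have pnu := is_part_addition pmu hnu; rewrite !size_oscs //.
have mu0 := nb_syt_neq0 pmu.
rewrite (sumn_addition pmu hnu); set Y := sumn mu.
have m0 : m.+1%:R != 0 :> rat by rewrite pnatr_eq0.
have Y0 : Y.+1%:R != 0 :> rat by rewrite pnatr_eq0.
have e2 : Y%:R / m.+1%:R * (nb_paths m.+1 Y)%:R
          = (if Y is Y'.+1 then nb_paths m Y' else 0%N)%:R :> rat.
  case: (Y) => [|Y']; first by rewrite !mul0r.
  rewrite mulrAC -natrM -nb_paths_removal natrM mulrAC divff ?mul1r //.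
have e1 : (nb_paths m.+1 Y)%:R = Y%:R / m.+1%:R * (nb_paths m.+1 Y)%:R
          + Y.+1%:R * (nb_paths m Y.+1)%:R :> rat.
  by rewrite e2 -natrM -natrD.
have e3 : (nb_paths m.+1 Y)%:R * (1 - Y%:R / m.+1%:R)
          = Y.+1%:R * (nb_paths m Y.+1)%:R :> rat.
  by rewrite mulrBr mulr1 {1}e1 mulrC addrC addKr.
rewrite !natrM (mulrAC (nb_paths m.+1 Y)%:R) e3.
by field; rewrite mu0 addrC natr1 Y0.
Qed.

(** The hook walk has total mass 1 except at the empty partition, where it has no outcome; the
    factor [sumn mu] vanishes there. *)
Lemma sum_removal_weights (m : nat) (mu : seq nat) : is_part mu ->
  \sum_(nu <- box_removals mu)
     (nb_syt nu)%:R / (nb_syt mu)%:R * ((sumn mu)%:R / m.+1%:R)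
  = (sumn mu)%:R / m.+1%:R :> rat.
Proof.
move=> pmu; have mu0 := nb_syt_neq0 pmu.
rewrite -mulr_suml -mulr_suml -natr_sum sum_nb_syt_removals // natrM mulfK //.
by case: (sumn mu) => [|Y] /=; rewrite ?mul1r // !mul0r.
Qed.

Lemma sum_addition_weights (mu : seq nat) : is_part mu ->
  \sum_(nu <- box_additions mu)
     (nb_syt nu)%:R / ((sumn mu).+1%:R * (nb_syt mu)%:R) = 1 :> rat.
Proof.
move=> pmu; have mu0 := nb_syt_neq0 pmu.
rewrite -mulr_suml -natr_sum sum_nb_syt_additions // -natrM divff //.
by rewrite natrM mulf_neq0 // pnatr_eq0.
Qed.

(** Uniformity as a loop invariant: the weight lemmas turn the count for [mu] times a transition
    probability into the count for [nu], to which induction applies. *)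
Lemma sample_loop_count {m N X : nat} {mu : seq nat} (T : seq (seq nat))
    (E : pred (seq (seq nat))) :
  is_part mu -> N = (X + m)%N ->
  (size (oscs m mu))%:R * Pr (sample_loop m N X (sumn mu) (mu :: T)) E
  = (count (fun V => E (V ++ T)) (oscs m mu))%:R.
Proof.
elim: m X mu T => [|m IH] X mu T pmu NE.
  (* With no step left, a nonempty [mu] has no tableau and both sides are 0. *)
  rewrite /= Pr_ret; case: ifP => [/eqP ->|] /=; rewrite ?mul0r //.
  by rewrite mul1r addn0.
have XN : (X < N)%N by rewrite NE addnS ltnS leq_addr.
have NE' : N = (X.+1 + m)%N by rewrite NE addnS.
have pE : removal_prob N X (sumn mu) = (sumn mu)%:R / m.+1%:R.
  by rewrite NE removal_probE.
rewrite Pr_sample_loopS // pE count_oscsS natrD !natr_sum mulrDr.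
rewrite (mulrA _ (_ / _)) (mulrA _ (1 - _)).
rewrite !mulr_sumr; congr (_ + _); apply: eq_big_seq => nu hnu.
  rewrite mulrA removal_weight // (sumn_removal pmu hnu) (IH X.+1) //.
    by congr _%:R; apply: eq_count => V; rewrite cat_rcons.
  exact: is_part_removal hnu.
rewrite mulrA addition_weight // -(sumn_addition pmu hnu) (IH X.+1) //.
  by congr _%:R; apply: eq_count => V; rewrite cat_rcons.
exact: is_part_addition hnu.
Qed.

Lemma Pr_sample_osc {N : nat} {la : seq nat} (E : pred (seq (seq nat))) :
  is_part la -> oscs N la != [::] ->
  Pr (sample_osc N la) E = (count E (oscs N la))%:R / (size (oscs N la))%:R.
Proof.
move=> pla; rewrite -size_eq0 => s0.
have := sample_loop_count [::] E pla (erefl N : N = (0 + N)%N).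
rewrite (eq_count (a2 := E)) => [<-|V]; last by rewrite cats0.
by rewrite mulrC mulKf // pnatr_eq0.
Qed.

(** By induction the continuation depends on the chosen partition only through its area, so it is
    constant on each branch and the hook-walk weights sum out. *)
Lemma Pr_sample_loop_areas {fuel N X : nat} {mu : seq nat} (T : seq (seq nat))
    (E : pred (seq nat)) :
  is_part mu -> N = (X + fuel)%N ->
  Pr (sample_loop fuel N X (sumn mu) (mu :: T)) (E \o areas)
  = Pr (walk_loop fuel N X (sumn mu) (areas (mu :: T))) E.
Proof.
elim: fuel X mu T => [|m IH] X mu T pmu NE; first by rewrite /= !Pr_ret.
have XN : (X < N)%N by rewrite NE addnS ltnS leq_addr.
have NE' : N = (X.+1 + m)%N by rewrite NE addnS.
have pE : removal_prob N X (sumn mu) = (sumn mu)%:R / m.+1%:R.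
  by rewrite NE removal_probE.
rewrite Pr_sample_loopS // [walk_loop _ _ _ _ _]/= Pr_choice pE; congr (_ + _).
  set c := Pr (walk_loop _ _ _ _ _) E.
  (* The branch probability stays with the hook-walk weights, so that the empty partition is
     covered. *)
  rewrite mulr_sumr -{2}(sum_removal_weights m mu pmu).
  rewrite mulr_suml; apply: eq_big_seq => nu hnu.
  rewrite mulrCA -[RHS]mulrA; congr (_ * (_ * _)).
  have e : (sumn mu).-1 = sumn nu by rewrite (sumn_removal pmu hnu).
  by rewrite /c e (IH X.+1) // (is_part_removal pmu).
congr (_ * _); set c := RHS.
rewrite -[RHS]mul1r -[X in X * c](sum_addition_weights mu pmu) mulr_suml.
apply: eq_big_seq => nu hnu; congr (_ * _).
by rewrite /c -(sumn_addition pmu hnu) (IH X.+1) // (is_part_addition pmu).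
Qed.

(** * Steps conditioned on the history *)

Lemma sum_size_oscs_removals (m : nat) (mu : seq nat) : is_part mu ->
  (\sum_(nu <- box_removals mu) size (oscs m nu))%:R
  = (size (oscs m.+1 mu))%:R * ((sumn mu)%:R / m.+1%:R) :> rat.
Proof.
move=> pmu; rewrite -[X in _ * X](sum_removal_weights m mu pmu) natr_sum mulr_sumr.
apply: eq_big_seq => nu hnu; rewrite -(removal_weight m mu pmu nu hnu).
by rewrite -mulrA; congr (_ * _); rewrite mulrC.
Qed.

Lemma sum_size_oscs_additions (m : nat) (mu : seq nat) : is_part mu ->
  (\sum_(nu <- box_additions mu) size (oscs m nu))%:R
  = (size (oscs m.+1 mu))%:R * (1 - (sumn mu)%:R / m.+1%:R) :> rat.
Proof.
move=> pmu; rewrite -[RHS]mulr1 -[X in _ * X](sum_addition_weights mu pmu).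
rewrite natr_sum mulr_sumr; apply: eq_big_seq => nu hnu.
by rewrite -(addition_weight m mu pmu nu hnu).
Qed.

(** The first step of the algorithm is the last one of [V]: as [V] has size [m.+2], indices [m] and
    [m.+1] fall inside it and hold [nu] and [mu]. *)
Lemma count_first_step (m : nat) (mu : seq nat) (b : seq (seq nat))
    (P : rel (seq nat)) : is_part mu ->
  count (fun V => P (nth [::] (V ++ b) m) (nth [::] (V ++ b) m.+1)) (oscs m.+1 mu)
  = (\sum_(nu <- box_removals mu) P nu mu * size (oscs m nu)
     + \sum_(nu <- box_additions mu) P nu mu * size (oscs m nu))%N.
Proof.
move=> pmu; rewrite count_oscsS.
have H nu : is_part nu ->
    count (fun V => P (nth [::] (rcons V mu ++ b) m) (nth [::] (rcons V mu ++ b) m.+1))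
      (oscs m nu) = (P nu mu * size (oscs m nu))%N.
  move=> pnu; rewrite (@eq_in_count _ _ (fun=> P nu mu)).
    by case: (P nu mu); rewrite ?count_predT ?count_pred0 ?mul1n.
  move=> V /(last_oscs pnu)[sV lV]; rewrite cat_rcons !nth_cat sV ltnSn ltnn subnn.
  by rewrite -lV -nth_last sV.
congr addn; apply: eq_big_seq => nu hnu; apply: H.
  exact: is_part_removal hnu.
exact: is_part_addition hnu.
Qed.

Lemma additions_removals_disjoint {mu nu : seq nat} : is_part mu ->
  nu \in box_removals mu -> nu \in box_additions mu -> False.
Proof. by move=> pmu /(sumn_removal pmu) + /(sumn_addition pmu) => -> ; lia. Qed.

Lemma count_removal_step (m : nat) (mu : seq nat) (b : seq (seq nat)) :
  is_part mu ->
  count (fun V => nth [::] (V ++ b) m \in box_removals (nth [::] (V ++ b) m.+1))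
    (oscs m.+1 mu)
  = (\sum_(nu <- box_removals mu) size (oscs m nu))%N.
Proof.
move=> pmu; rewrite (count_first_step m mu b (fun x y => x \in box_removals y)) //.
rewrite [X in (_ + X)%N]big1_seq ?addn0; last first.
  move=> nu /= h; case: (boolP (_ \in _)) => // h'.
  by case: (additions_removals_disjoint pmu h' h).
by apply: eq_big_seq => nu ->; rewrite mul1n.
Qed.

Lemma count_addition_step (m : nat) (mu : seq nat) (b : seq (seq nat)) :
  is_part mu ->
  count (fun V => nth [::] (V ++ b) m \in box_additions (nth [::] (V ++ b) m.+1))
    (oscs m.+1 mu)
  = (\sum_(nu <- box_additions mu) size (oscs m nu))%N.
Proof.
move=> pmu; rewrite (count_first_step m mu b (fun x y => x \in box_additions y)) //.
rewrite [X in (X + _)%N]big1_seq ?add0n; last first.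
  move=> nu /= h; case: (boolP (_ \in _)) => // h'.
  by case: (additions_removals_disjoint pmu h h').
by apply: eq_big_seq => nu ->; rewrite mul1n.
Qed.

Lemma cPr_sample_osc {N : nat} {la : seq nat} (E H : pred (seq (seq nat))) :
  is_part la -> oscs N la != [::] ->
  cPr (sample_osc N la) E H
  = (count E [seq T <- oscs N la | H T])%:R / (count H (oscs N la))%:R.
Proof.
move=> pla s0; rewrite /cPr !Pr_sample_osc // count_filter invf_div mulrA.
by rewrite mulfVK // pnatr_eq0 size_eq0.
Qed.

Theorem mainTheorem1 (la : seq nat) (k n N : nat)
    (la_part : is_part la) (la_area : sumn la = k) (defN : N = (k + 2 * n)%N) :
  (* the output is uniform on the oscillating tableaux of length N, shape la *)
  exists s : seq (seq (seq nat)),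
    [/\ uniq s, s =i osc_tableau N la & s != [::]] /\
    [/\ same_law (sample_osc N la) (unif s),
        (* given all the partitions visited so far, the law of the choice made
           at step X is a function of X and of the area of the current one *)
        forall (X : nat) (h : seq (seq nat)), (X < N)%N ->
          Pr (sample_osc N la) (history N X h) != 0 ->
          let p := removal_prob N X (sumn (head [::] h)) in
          [/\ 0 <= p <= 1,
              cPr (sample_osc N la) (removes_at N X) (history N X h) = p
            & cPr (sample_osc N la) (adds_at N X) (history N X h) = 1 - p]
      & (* the areas perform a random walk that does not involve the shapes *)
        same_law (dmap areas (unif s)) (area_walk N k)].
Proof.
have s0 : oscs N la != [::].
  rewrite -size_eq0 -lt0n size_oscs // muln_gt0 nb_syt_gt0 // andbT.
  by rewrite la_area defN nb_paths_gt0.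
exists (oscs N la); split.
  by split=> [||//]; [exact: oscs_uniq | move=> T; rewrite mem_oscs].
split.
- by move=> E; rewrite Pr_sample_osc // Pr_unif.
- move=> X h XN; rewrite Pr_sample_osc // => hH p.
  (* [m] is the number of steps left after step [X]; the current partition has index [m.+1] and the
     next one index [m]. *)
  have [m NE] : exists m, N = (X + m.+1)%N.
    by exists (N - X).-1; rewrite prednK ?subn_gt0 // subnKC // ltnW.
  have NX : (N - X = m.+1)%N by rewrite NE addKn.
  have NX1 : (N - X.+1 = m)%N by rewrite subnS NX.
  (* A history of nonzero probability is that of some oscillating tableau, to which [oscs_history]
     applies. *)
  have [T0 hT0 /eqP] : exists2 T, T \in oscs N la & history N X h T.
    apply/hasP; rewrite has_count lt0n; apply: contraNneq hH => ->.
    by rewrite mul0r.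
  rewrite NX => hE.
  have := @oscs_history m.+1 X la T0 la_part; rewrite addnC -NE => /(_ hT0); cbv zeta.
  rewrite hE; set mu := head [::] h; set b := behead h => -[pmu hp].
  have pE : p = (sumn mu)%:R / m.+1%:R by rewrite /p NE removal_probE.
  have cH : count (history N X h) (oscs N la) = size (oscs m.+1 mu).
    by rewrite -size_filter /history NX (perm_size hp) size_map.
  have O0 : (size (oscs m.+1 mu))%:R != 0 :> rat.
    rewrite -cH; apply: contraNneq hH => ->; by rewrite mul0r.
  have cE E : count E [seq T <- oscs N la | history N X h T]
              = count (fun V => E (V ++ b)) (oscs m.+1 mu).
    by rewrite /history NX (permP hp) count_map.
  split.
  (* For the upper bound, [1 - p] times the positive number of completions of the history is itself
     a number of tableaux. *)
  + rewrite pE divr_ge0 ?ler0n //= -subr_ge0.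
    rewrite -(pmulr_rge0 _ (_ : 0 < (size (oscs m.+1 mu))%:R)) ?lt0r ?O0 ?ler0n //.
    by rewrite -sum_size_oscs_additions // ler0n.
  + rewrite cPr_sample_osc // cH cE /removes_at NX NX1 count_removal_step //.
    by rewrite sum_size_oscs_removals // -pE mulrAC divff // mul1r.
  + rewrite cPr_sample_osc // cH cE /adds_at NX NX1 count_addition_step //.
    by rewrite sum_size_oscs_additions // -pE mulrAC divff // mul1r.
move=> E; rewrite Pr_dmap Pr_unif -Pr_sample_osc // /area_walk -la_area.
exact: (Pr_sample_loop_areas [::] E la_part (erefl N : N = (0 + N)%N)).
Qed.
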